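(* There is an absolute constant $C>0$ such that, for all integers $d,n\ge 1$ and $r\ge 2$, every $n$-uniform family $\mathcal F$ of subsets of a finite set with $\mathrm{VC}(\mathcal F)\le d$ and $|\mathcal F|>(C\,r\log(d+1))^n$ contains an $r$-sunflower.
   Context: $\log$ is the natural logarithm. A family is $n$-uniform if all its members have size exactly $n$. VC dimension: a set $D\subseteq U$ (where $U$ is the ground set) is shattered by $\mathcal F\subseteq 2^U$ if $\{S\cap D:S\in\mathcal F\}=2^D$; $\mathrm{VC}(\mathcal F)$ is the largest size of a set shattered by $\mathcal F$. Distinct sets $S_1,\ldots,S_r$ form an $r$-sunflower if $S_i\cap S_j$ is the same set for all $i\ne j$. *)

(* Defs.v *)
From mathcomp Require Import all_boot.

Set Implicit Arguments.
Unset Strict Implicit.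
Unset Printing Implicit Defensive.

(* The ground set is the whole finite type T. *)

Definition uniform_family (T : finType) (n : nat) (F : {set {set T}}) : Prop :=
  forall S : {set T}, S \in F -> #|S| = n.

Definition shatters (T : finType) (F : {set {set T}}) (D : {set T}) : bool :=
  [set S :&: D | S in F] == powerset D.

(* The empty family shatters no set; its VC dimension is 0 here, the value of
   the empty maximum. *)
Definition VC (T : finType) (F : {set {set T}}) : nat :=
  \max_(D : {set T} | shatters F D) #|D|.

Definition is_sunflower (T : finType) (r : nat) (S : 'I_r -> {set T}) : Prop :=
  injective S /\
  exists K : {set T}, forall i j : 'I_r, i != j -> S i :&: S j = K.

Definition contains_sunflower (T : finType) (r : nat) (F : {set {set T}}) :
    Prop :=
  exists S : 'I_r -> {set T}, (forall i, S i \in F) /\ is_sunflower S.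

(* Main.v *)
(* A maximizer C of #|{S in F : C \subset S}| q ^ #|C| has a link that is
   q-spread: a nonempty set A lies in at most a fraction q ^ - #|A| of its members.
   Color the ground set with 2 r groups of k + 1 = O(log (d + 1)) colors, where q is
   a large multiple of the number M of colors. It suffices that, for at least half
   of the colorings, the union of the classes of a given group contains a member
   of the link: then some coloring serves r groups, giving r disjoint members.

   The colors of a group are exposed one at a time, each member s being replaced
   by its minimal fragment: the smallest set phi(s') minus the new class among the
   s' with phi(s') contained in phi(s) and that class. As in the Park-Pham argument,
   the fraction of members whose fragment has at least t elements is at most
   max_(s') \sum_(T \subset phi(s'), #|T| >= t) M ^ #|T| P(T \subset phi(s)).
   For members of size at most 2 t this is at most (4 M / q) ^ t, so each color
   halves the fragments; the point is to make the first color bring them from n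
   down to O(d ^ 2), independently of n.

   For this the displayed sum is averaged over s'. Let U_j be the set of the points
   of degree greater than q ^ - j. By spread, E q ^ #|phi(s) & U_j| is at most the
   number of traces on U_j, which by Sauer-Shelah is controlled by
   #|U_j| <= q ^ j E #|phi(s) & U_j|. This self-bounding inequality forces
   E #|phi(s) & U_j| <= 2 j d whatever n is. An intersection of two members whose
   degree is about q ^ - j lies in U_(j + 1), where a typical s' has only
   d ^ d e ^ O(j) traces, and the factor (M / q) ^ j beats this for j >= d ^ 2. *)
Require Import Defs.
From mathcomp Require Import all_boot all_order all_algebra.
From mathcomp Require Import reals sequences exp.
From mathcomp Require Import ring lra zify.

Set Implicit Arguments.
Unset Strict Implicit.
Unset Printing Implicit Defensive.

Import Order.TTheory GRing.Theory Num.Theory.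

(** * Shattered sets and the Sauer-Shelah bound on traces *)

Lemma shattersP (T : finType) (F : {set {set T}}) (D : {set T}) :
  reflect (forall B : {set T}, B \subset D -> exists2 S, S \in F & S :&: D = B)
          (shatters F D).
Proof.
apply: (iffP eqP) => [E B sBD | H].
  have /imsetP[S SF ->] : B \in [set S :&: D | S in F] by rewrite E powersetE.
  by exists S.
apply/setP=> B; rewrite powersetE; apply/imsetP/idP => [[S _ ->]|/H[S SF <-]].
  exact: subsetIr.
by exists S.
Qed.

(** Induction on a set [X] containing all members. Splitting at a point [x] gives [F0] and [F1] on
    [X :\ x]; a set shattered by both is counted twice, and [F] then shatters it with and without
    [x]. *)
Lemma pajor (T : finType) (F : {set {set T}}) :
  #|F| <= #|[set D | shatters F D]|.
Proof.
have [X FX] : exists X : {set T}, F \subset powerset X.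
  by exists setT; apply/subsetP=> S _; rewrite powersetE subsetT.
have [n] := ubnP #|X|; elim: n X F FX => // n IHn X F FX ltXn.
have [X0|[x xX]] := set_0Vmem X.
  have [->|[S SF]] := set_0Vmem F; first by rewrite cards0.
  have F1 : F \subset [set set0].
    by apply: subset_trans FX _; rewrite X0 powerset0.
  have S0 : S = set0 by move: (subsetP F1 S SF); rewrite inE => /eqP.
  apply: leq_trans (subset_leq_card F1) _; rewrite cards1 card_gt0.
  apply/set0Pn; exists set0; rewrite inE; apply/shattersP => B.
  by rewrite subset0 => /eqP ->; exists S => //; rewrite setI0.
pose F0 := [set S in F | x \notin S].
pose F1 := [set S :\ x | S in [set S in F | x \in S]].
have ltX : #|X :\ x| < n by rewrite (cardsD1 x X) xX in ltXn.
have F0X : F0 \subset powerset (X :\ x).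
  apply/subsetP=> S; rewrite inE powersetE subsetD1 => /andP[SF ->].
  by rewrite andbT -powersetE (subsetP FX).
have F1X : F1 \subset powerset (X :\ x).
  apply/subsetP=> S /imsetP[S1]; rewrite inE => /andP[SF xS] ->.
  by rewrite powersetE setSD // -powersetE (subsetP FX).
have cF : #|F| = #|F0| + #|F1|.
  rewrite card_in_imset => [|S1 S2]; last first.
    by rewrite !inE => /andP[_ x1] /andP[_ x2] E; rewrite -(setD1K x1) E setD1K.
  rewrite -(cardsID [set S : {set T} | x \notin S] F); congr (_ + _).
    by apply: eq_card => S; rewrite !inE.
  by apply: eq_card => S; rewrite !inE negbK andbC.
have nx (G : {set {set T}}) (D : {set T}) : G \subset powerset (X :\ x) -> shatters G D -> x \notin D.
  move=> GX /shattersP /(_ D (subxx _))[S /(subsetP GX)].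
  by rewrite powersetE subsetD1 => /andP[_ xS] <-; rewrite inE (negPf xS).
pose Sh0 := [set D | shatters F0 D]; pose Sh1 := [set D | shatters F1 D].
have sh0 (D : {set T}) : shatters F0 D -> shatters F D.
  move/shattersP=> H; apply/shattersP => B /H[S].
  by rewrite inE => /andP[SF _] <-; exists S.
have sh1 (D : {set T}) : shatters F1 D -> shatters F D.
  move=> shD; have xD := nx _ _ F1X shD; move/shattersP: shD => H.
  apply/shattersP => B /H[S /imsetP[S1]]; rewrite inE => /andP[SF xS] -> <-.
  exists S1 => //; apply/setP=> y; rewrite !inE; case: eqP => // -> /=.
  by rewrite (negPf xD) andbF.
have sh2 (D : {set T}) : shatters F0 D -> shatters F1 D -> shatters F (x |: D).
  move=> h0 h1; have xD := nx _ _ F0X h0.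
  move/shattersP: h0 => h0; move/shattersP: h1 => h1.
  apply/shattersP=> B BD; have [xB|xB] := boolP (x \in B).
    have /h1[S /imsetP[S1]] : B :\ x \subset D by rewrite subDset.
    rewrite inE => /andP[SF xS] -> E; exists S1 => //.
    apply/setP=> y; move/setP/(_ y): E; rewrite !inE.
    by case: eqP => [->|_] //=; rewrite xS xB.
  have /h0[S] : B \subset D.
    apply/subsetP => y yB; move: (subsetP BD y yB); rewrite !inE.
    by case: eqP => // E; rewrite E (negPf xB) in yB.
  rewrite inE => /andP[SF xS] E; exists S => //.
  apply/setP=> y; move/setP/(_ y): E; rewrite !inE.
  by case: eqP => [->|_] //=; rewrite (negPf xS) (negPf xB).
have le1 : #|F| <= #|Sh0| + #|Sh1|.
  by rewrite cF leq_add //; apply: (IHn (X :\ x)).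
apply: leq_trans le1 _; rewrite -cardsUI.
have inj : {in Sh0 :&: Sh1 &, injective (fun D => x |: D)}.
  move=> D1 D2; rewrite !inE => /andP[h1 _] /andP[h2 _] E.
  have n1 := nx _ _ F0X h1; have n2 := nx _ _ F0X h2.
  by rewrite -(setU1K n1) E setU1K.
rewrite -(card_in_imset inj) -cardsUI.
have -> : (Sh0 :|: Sh1) :&: [set x |: D | D in Sh0 :&: Sh1] = set0.
  apply/setP=> D; rewrite !inE; apply/negP => /andP[h /imsetP[D1 _ E]].
  suff : x \notin D by rewrite E setU11.
  by case/orP: h; apply: nx.
rewrite cards0 addn0; apply: subset_leq_card; apply/subsetP => D.
rewrite !inE => /orP[/orP[/sh0|/sh1]|/imsetP[D1]] //.
by rewrite !inE => /andP[h0 h1] ->; apply: sh2.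
Qed.

Lemma card_bigcup_le (T I : finType) (E : I -> {set T}) :
  #|\bigcup_i E i| <= \sum_i #|E i|.
Proof.
elim/big_rec2: _ => [|i m A _ leA]; first by rewrite cards0.
by apply: leq_trans (leq_card_setU _ _) _; rewrite leq_add2l.
Qed.

(** Pajor's inequality is applied to the traces: a set they shatter lies in [X] and is shattered by
    [F], so it has at most [d] elements. *)
Lemma sauer_shelah (T : finType) (F : {set {set T}}) (d : nat) (X : {set T}) :
  VC F <= d ->
  #|[set S :&: X | S in F]| <= \sum_(i < d.+1) 'C(#|X|, i).
Proof.
move=> vcF; apply: leq_trans (pajor _) _.
pose E (i : 'I_d.+1) := [set D : {set T} | D \subset X & #|D| == i].
rewrite (eq_bigr (fun i => #|E i|)) => [|i _]; last by rewrite cards_draws.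
apply: leq_trans (card_bigcup_le E).
apply: subset_leq_card; apply/subsetP=> D; rewrite inE => /shattersP shD.
have DX : D \subset X.
  have [_ /imsetP[S _ ->] E1] := shD D (subxx _).
  by rewrite -E1 -setIA setIC -setIA subsetIl.
have shF : shatters F D.
  apply/shattersP => B /shD[_ /imsetP[S SF ->] <-]; exists S => //.
  by rewrite -setIA (setIidPr DX).
have leD : #|D| < d.+1.
  by rewrite ltnS (leq_trans _ vcF) // /VC; apply: (leq_bigmax_cond D shF).
by apply/bigcupP; exists (Ordinal leD) => //; rewrite inE DX /=.
Qed.

Local Open Scope ring_scope.

(** Since [lam ^+ d <= lam ^+ i] for [i <= d], the left side is at most [(1 + lam) ^+ x]. Later
    [lam] is [q ^ - j] or [1 / d]. *)
Lemma sum_bin_le_exp (R : realType) (x d : nat) (lam : R) :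
  0 <= lam -> lam <= 1 ->
  (\sum_(i < d.+1) 'C(x, i))%N%:R * lam ^+ d <= expR (lam * x%:R).
Proof.
move=> lam0 lam1.
have bin k : \sum_(i < k) 'C(x, i)%:R * lam ^+ i <= (1 + lam) ^+ x.
  elim: x k => [|y IHy] [|k]; rewrite ?big_ord0 ?exprn_ge0 ?addr_ge0 //.
    by rewrite big_ord_recl bin0 big1 ?addr0 ?mulr1 // => i _; rewrite mul0r.
  rewrite big_ord_recl bin0.
  under eq_bigr do rewrite lift0 binS natrD mulrDl.
  rewrite big_split /= addrA exprS mulrDl mul1r lerD //.
    apply: le_trans (IHy k.+1); rewrite big_ord_recl bin0 lerD2l.
    by apply: ler_sum => i _; rewrite lift0.
  apply: le_trans (ler_wpM2l lam0 (IHy k)); rewrite mulr_sumr.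
  by apply: ler_sum => i _; rewrite exprS mulrCA.
apply: (@le_trans _ _ ((1 + lam) ^+ x)); last first.
  by rewrite expRM_natr lerXn2r ?nnegrE ?expR_ge0 ?addr_ge0 ?expR_ge1Dx.
apply: le_trans (bin d.+1); rewrite natr_sum mulr_suml ler_sum // => i _.
by rewrite ler_wpM2l // ler_wiXn2l // -ltnS.
Qed.

(** * Second moment bound for spread families with few traces *)

Section SecondMoment.
Variables (R : realType) (V J : finType).
Variables (I : {set J}) (phi : J -> {set V}).

Definition degree (A : {set V}) : nat := #|[set s in I | A \subset phi s]|.

Definition trace_number (X : {set V}) : nat := #|[set phi s :&: X | s in I]|.

Variables (q d : nat).
Hypothesis spread : forall A, (degree A * q ^ #|A| <= #|I|)%N.
Hypothesis few_traces :
  forall X, (trace_number X <= \sum_(i < d.+1) 'C(#|X|, i))%N.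
Hypothesis q_ge : expR 2 <= q%:R :> R.
Hypothesis d_gt0 : (0 < d)%N.

Definition heavy (j : nat) : {set V} :=
  [set v | (#|I| < degree [set v] * q ^ j)%N].

(** Members are grouped by their trace [B]; by spread at most [#|I| / q ^ #|B|] of them contain [B],
    so each trace contributes at most [#|I|]. *)
Lemma sum_exp_trace_le (X : {set V}) :
  (\sum_(s in I) q ^ #|phi s :&: X| <= #|I| * trace_number X)%N.
Proof.
rewrite (partition_big_imset (fun s => phi s :&: X)) /= mulnC -sum_nat_const.
apply: leq_sum => B _; apply: leq_trans (spread B).
rewrite (eq_bigr (fun=> q ^ #|B|)%N) => [|s /andP[_ /eqP ->] //].
rewrite sum_nat_cond_const leq_mul2r; apply/orP; right.
apply: subset_leq_card; apply/subsetP => s; rewrite !inE => /andP[-> /eqP <-].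
exact: subsetIl.
Qed.

Lemma card_heavy_le (j : nat) :
  (#|heavy j| * #|I| <= q ^ j * \sum_(s in I) #|phi s :&: heavy j|)%N.
Proof.
have -> : (\sum_(s in I) #|phi s :&: heavy j| =
           \sum_(v in heavy j) degree [set v])%N.
  under eq_bigr do rewrite -sum1_card.
  under [RHS]eq_bigr do rewrite /degree -sum1_card.
  rewrite (exchange_big_dep (mem (heavy j))) /=; last first.
    by move=> s v _; rewrite inE => /andP[].
  apply: eq_bigr => v vj; apply: eq_bigl => s.
  by rewrite in_setI vj andbT inE sub1set.
rewrite -sum_nat_const big_distrr /=; apply: leq_sum => v.
by rewrite inE mulnC => /ltnW.
Qed.

Let N : R := #|I|%:R.
Let L : R := ln q%:R.

Lemma q_gt0 : 0 < q%:R :> R.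
Proof. by apply: lt_le_trans q_ge; rewrite expR_gt0. Qed.

Lemma q_exp (n : nat) : (q ^ n)%:R = expR (L * n%:R) :> R.
Proof. by rewrite expRM_natr lnK ?posrE ?q_gt0 // natrX. Qed.

Lemma L_ge2 : 2 <= L.
Proof. by rewrite -ler_expR lnK ?posrE ?q_gt0. Qed.

Hypothesis I_gt0 : (0 < #|I|)%N.

Lemma N_gt0 : 0 < N. Proof. by rewrite ltr0n. Qed.

(* With m the mean of |phi s :&: heavy j|, Jensen bounds q ^ m by the number of
   traces on [heavy j], while [card_heavy_le] makes the Sauer-Shelah bound on
   that number at most q ^ (j d) e ^ m; comparing the two gives m <= 2 j d. *)
Lemma trace_number_heavy_le (j : nat) :
  (trace_number (heavy j))%:R <= (q ^ (2 * j * d))%:R :> R.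
Proof.
have mean_le (a m l : R) :
    0 <= a -> 2 <= l -> l * m <= l * a + m -> m <= 2 * a.
  move=> a0 l2 h; have : 0 <= a * (l - 2) by rewrite mulr_ge0 // subr_ge0.
  have -> : (m <= 2 * a) = ((m - 2 * a) * (l - 1) <= 0).
    by rewrite pmulr_lle0 ?subr_le0 //; lra.
  by lra.
set tr : R := (trace_number _)%:R.
pose x s := #|phi s :&: heavy j|; pose m : R := (\sum_(s in I) x s)%:R / N.
have N0 := N_gt0; have L2 := L_ge2.
have q1 : (1 <= q ^ j)%N by rewrite expn_gt0 -(ltr0n R) q_gt0.
have jensen : expR (L * m) <= tr.
  rewrite -(ler_pM2l N0).
  have -> : N * tr = (#|I| * trace_number (heavy j))%:R by rewrite natrM.
  apply: (@le_trans _ _ (\sum_(s in I) q ^ x s)%:R); last first.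
    by rewrite ler_nat sum_exp_trace_le.
  rewrite natr_sum.
  (* Jensen by hand: the exponential lies above its tangent at [L * m], whose linear term averages
     to zero. *)
  apply: (@le_trans _ _
    (\sum_(s in I) expR (L * m) * (1 + (L * (x s)%:R - L * m)))); last first.
    apply: ler_sum => s _; rewrite q_exp.
    rewrite -[X in _ <= expR X](subrK (L * m)) expRD [leRHS]mulrC.
    by rewrite ler_wpM2l ?expR_ge0 ?expR_ge1Dx.
  rewrite -mulr_sumr mulrC ler_wpM2l ?expR_ge0 //.
  rewrite big_split /= sumr_const -/N sumrB sumr_const -mulr_sumr -natr_sum.
  rewrite -[(L * m) *+ _]mulr_natr -/N.
  have -> : (\sum_(s in I) x s)%N%:R = m * N by rewrite mulfVK ?gt_eqF.
  by rewrite mulrA subrr addr0.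
have trle : tr <= expR (L * (j * d)%:R + m).
  have lam0 : 0 < (q ^ j)%:R :> R by rewrite ltr0n.
  have lam1 : ((q ^ j)%:R)^-1 <= 1 :> R by rewrite invf_le1 // ler1n.
  have := sum_bin_le_exp #|heavy j| d (ltW (eqbRL (invr_gt0 _) lam0)) lam1.
  rewrite exprVn ler_pdivrMr ?exprn_gt0 // => le1.
  apply: (@le_trans _ _ (\sum_(i < d.+1) 'C(#|heavy j|, i))%N%:R).
    by rewrite ler_nat few_traces.
  apply: le_trans le1 _; rewrite expRD -q_exp -natrX -expnM mulrC.
  rewrite ler_wpM2l // ler_expR mulrC ler_pdivrMr // /m mulrAC ler_pdivlMr //.
  by rewrite -!natrM ler_nat mulnC [X in (_ <= X)%N]mulnC mulnC card_heavy_le.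
have mle : m <= 2 * (j * d)%:R.
  have := le_trans jensen trle; rewrite ler_expR.
  exact: mean_le.
apply: le_trans trle _; rewrite q_exp ler_expR -mulnA natrM.
have : 0 <= (j * d)%:R * (L - 2) by rewrite mulr_ge0 // subr_ge0.
by lra.
Qed.

(** With x the trace size, Sauer-Shelah bounds each term by d^d e^(x/d). If x <= 2jd, the
    exponential is at most e^(2j); otherwise it is at most e^(2j) q^x / Q, and q^x / Q has mean at
    most 1 by [trace_number_heavy_le]. *)
Lemma sum_trace_number_le (j : nat) :
  \sum_(s in I) (trace_number (phi s :&: heavy j))%:R
    <= 2 * (d ^ d)%:R * expR (2 * j%:R) * N.
Proof.
pose x s : R := #|phi s :&: heavy j|%:R.
have d0 : 0 < d%:R :> R by rewrite ltr0n.
have N0 := N_gt0; have L2 := L_ge2.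
have tr_le s : (trace_number (phi s :&: heavy j))%:R
    <= (d ^ d)%:R * expR (x s / d%:R).
  apply: (@le_trans _ _ (\sum_(i < d.+1) 'C(#|phi s :&: heavy j|, i))%N%:R).
    by rewrite ler_nat few_traces.
  have lam1 : d%:R^-1 <= 1 :> R by rewrite invf_le1 // ler1n.
  have := sum_bin_le_exp #|phi s :&: heavy j| d
    (ltW (eqbRL (invr_gt0 _) d0)) lam1.
  by rewrite exprVn ler_pdivrMr ?exprn_gt0 // natrX mulrC [_^-1 * _]mulrC.
pose Q : R := (q ^ (2 * j * d))%:R.
have Q0 : 0 < Q by rewrite /Q q_exp expR_gt0.
have exp_le s : expR (x s / d%:R)
    <= expR (2 * j%:R) * (1 + (q ^ #|phi s :&: heavy j|)%:R / Q).
  have [le_x|lt_x] := leP (x s) (2 * j%:R * d%:R).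
    rewrite -[leLHS]mulr1 ler_pM ?expR_ge0 ?ler_expR ?ler_pdivrMr //.
    by rewrite lerDl divr_ge0 // ltW.
  rewrite -[x s / _](subrK (2 * j%:R)) addrC expRD ler_wpM2l ?expR_ge0 //.
  rewrite /Q !q_exp -expRB -/(x s) !natrM.
  apply: ler_wpDl => //; rewrite ler_expR -mulrBr.
  apply: (@le_trans _ _ (x s - 2 * j%:R * d%:R)).
    have -> : x s / d%:R - 2 * j%:R = (x s - 2 * j%:R * d%:R) / d%:R.
      by rewrite mulrBl mulfK ?gt_eqF.
    by rewrite ler_pdivrMr // ler_peMr ?ler1n // subr_ge0 ltW.
  by rewrite ler_peMl ?subr_ge0 ?(ltW lt_x) //; lra.
apply: (@le_trans _ _ (\sum_(s in I) (d ^ d)%:R * (expR (2 * j%:R) *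
    (1 + (q ^ #|phi s :&: heavy j|)%:R / Q)))).
  apply: ler_sum => s _; apply: le_trans (tr_le s) _.
  by rewrite ler_wpM2l.
rewrite -!mulr_sumr big_split /= sumr_const -/N -mulr_suml -natr_sum.
have le1 : (\sum_(s in I) q ^ #|phi s :&: heavy j|)%N%:R / Q <= N.
  rewrite ler_pdivrMr //.
  apply: (@le_trans _ _ (#|I| * trace_number (heavy j))%:R).
    by rewrite ler_nat sum_exp_trace_le.
  by rewrite natrM ler_wpM2l ?(ltW N0) // trace_number_heavy_le.
have -> : 2 * (d ^ d)%:R * expR (2 * j%:R) * N =
    (d ^ d)%:R * (expR (2 * j%:R) * (N + N)) by ring.
by rewrite !ler_wpM2l ?expR_ge0 // lerD2l.
Qed.

Variable M : nat.
Hypothesis M_gt0 : (0 < M)%N.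

(** Up to the factor [#|I|], the Park-Pham sum of M^|T| times the probability that a random member
    contains [T]. *)
Definition overlap_weight (t : nat) (X : {set V}) : nat :=
  \sum_(T : {set V} | (T \subset X) && (t <= #|T|)%N) M ^ #|T| * degree T.

(* Pairs s, s' are classified by the level j with
   q ^ j <= #|I| / degree (phi s :&: phi s') < q ^ j.+1. *)
Lemma overlap_weight_le (t : nat) (s' : J) : s' \in I ->
  (overlap_weight t (phi s'))%:R <=
    \sum_(j < #|I|.+1 | (t <= j)%N) N * ((2 * M)%:R / q%:R) ^+ j *
      (trace_number (phi s' :&: heavy j.+1))%:R :> R.
Proof.
move=> s'I; pose A s := phi s :&: phi s'.
have q1 : (1 < q)%N.
  by rewrite -(ltr1n R) (lt_le_trans _ q_ge) // expR_gt1.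
have deg_gt0 s : s \in I -> (0 < degree (A s))%N.
  by move=> sI; apply/card_gt0P; exists s; rewrite inE sI subsetIl.
have degI T : (degree T <= #|I|)%N.
  by apply: subset_leq_card; apply/subsetP => s; rewrite inE => /andP[].
pose lev s := trunc_log q (#|I| %/ degree (A s)).
have levP s : s \in I ->
    (degree (A s) * q ^ lev s <= #|I| < degree (A s) * q ^ (lev s).+1)%N.
  move=> sI; have d1 := deg_gt0 s sI.
  have /andP[] : (q ^ lev s <= #|I| %/ degree (A s) < q ^ (lev s).+1)%N.
    by apply: trunc_log_bounds => //; rewrite divn_gt0.
  by rewrite leq_divRL // ltn_divLR // mulnC => -> h; rewrite mulnC h.
have lev_lt s : s \in I -> (lev s < #|I|.+1)%N.
  move=> sI; rewrite ltnS; have /andP[h _] := levP s sI.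
  apply: leq_trans h; apply: leq_trans (leq_pmull _ (deg_gt0 s sI)).
  exact/ltnW/ltn_expl.
have card_lev s : s \in I -> (#|A s| <= lev s)%N.
  move=> sI; have /andP[_ h] := levP s sI.
  have := leq_ltn_trans (spread (A s)) h.
  by rewrite ltn_pmul2l ?deg_gt0 // ltn_exp2l.
have A_heavy s : s \in I -> A s \subset heavy (lev s).+1.
  move=> sI; apply/subsetP => v vA; rewrite inE.
  have /andP[_ h] := levP s sI; apply: leq_trans h _.
  rewrite leq_mul2r; apply/orP; right; apply: subset_leq_card.
  apply/subsetP => s1; rewrite !inE sub1set => /andP[-> /subsetP]; exact.
(* Intersections at level [j] are traces on [heavy j.+1], and each lies in at most [#|I| / q ^ j]
   members. *)
have count j : ((\sum_(s in I | lev s == j) 1) * q ^ j <=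
    #|I| * trace_number (phi s' :&: heavy j.+1))%N.
  rewrite (partition_big A (mem [set phi s :&: (phi s' :&: heavy j.+1) | s in I]))
    /=; last first.
    move=> s /andP[sI /eqP E]; apply/imsetP; exists s => //.
    by rewrite setIA -/(A s); apply/esym/setIidPl; rewrite -E A_heavy.
  rewrite big_distrl mulnC -sum_nat_const /=; apply: leq_sum => B _.
  have [s0 /= /andP[/andP[s0I /eqP <-] /eqP EB]|none] :=
    pickP [pred s | [&& s \in I & lev s == j] && (A s == B)]; last first.
    by rewrite big_pred0 // => s; have := none s.
  have /andP[h _] := levP s0 s0I; apply: leq_trans h; rewrite EB.
  rewrite leq_mul2r; apply/orP; right; rewrite sum1_card.
  apply: subset_leq_card; apply/subsetP => s; rewrite !inE.
  by move=> /andP[/andP[-> _] /eqP <-]; rewrite subsetIl.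
(* After exchanging the sums, [s] contributes only subsets of [A s]: at most [2 ^ lev s] terms, each
   at most [M ^ lev s], and none if [lev s < t]. *)
have le1 : (overlap_weight t (phi s') <=
    \sum_(s in I | (t <= lev s)%N) (2 * M) ^ lev s)%N.
  rewrite /overlap_weight.
  under [leqLHS]eq_bigr do rewrite mulnC /degree -sum_nat_const.
  rewrite (exchange_big_dep (mem I)) /=; last first.
    by move=> T s _; rewrite inE => /andP[].
  rewrite [leqRHS]big_mkcondr; apply: leq_sum => s sI.
  have sub (T : {set V}) : T \subset phi s' -> s \in [set s in I | T \subset phi s] ->
      T \subset A s.
    by move=> h; rewrite inE => /andP[_ h2]; rewrite /A subsetI h h2.
  case: ifP => [_|/negbT]; last first.
    rewrite -ltnNge => lt; rewrite big1 // => T /andP[/andP[Ts' tT] Ts].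
    have := leq_trans (subset_leq_card (sub T Ts' Ts)) (card_lev s sI).
    by rewrite leqNgt (leq_trans lt tT).
  apply: (@leq_trans (\sum_(T in powerset (A s)) M ^ lev s)%N).
    rewrite big_mkcond [leqRHS]big_mkcond; apply: leq_sum => T _.
    case: ifP => // /andP[/andP[Ts' tT] Ts].
    have TA := sub T Ts' Ts; rewrite powersetE TA leq_pexp2l //.
    exact: leq_trans (subset_leq_card TA) (card_lev s sI).
  rewrite sum_nat_const card_powerset expnMn leq_mul2r.
  by rewrite leq_pexp2l ?orbT ?card_lev.
apply: (@le_trans _ _ (\sum_(s in I | (t <= lev s)%N) (2 * M) ^ lev s)%N%:R).
  by rewrite ler_nat.
rewrite (partition_big (fun s => inord (lev s) : 'I_#|I|.+1)
  (fun j => t <= j)%N) /=; last first.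
  by move=> s /andP[sI ts]; rewrite inordK ?lev_lt.
rewrite natr_sum; apply: ler_sum => j tj.
rewrite (eq_bigl (fun s => (s \in I) && (lev s == j))) => [|s]; last first.
  have [sI|//] := boolP (s \in I); rewrite /= -val_eqE /= inordK ?lev_lt //.
  by case: eqP => [->|]; rewrite ?tj ?andbF.
rewrite (eq_bigr (fun=> 1 * (2 * M) ^ j)%N) => [|s /andP[_ /eqP ->]]; last first.
  by rewrite mul1n.
rewrite -big_distrl /= natrM expr_div_n -!natrX.
have -> (a b c : R) : N * (a / b) * c = N * c * a / b by ring.
rewrite ler_pdivlMr ?ltr0n ?expn_gt0 ?(ltnW q1) // mulrAC ler_wpM2r //.
by rewrite /N -!natrM ler_nat count.
Qed.

(** Averaging leaves d^d times the tail from [t] of a geometric series of ratio [b]. As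
    [d * d <= t], d^d is at most 2^t, and (2b)^t <= 2b keeps one factor [c]. *)
Lemma sum_overlap_weight_le (t : nat) : (d * d <= t)%N -> (0 < t)%N ->
  let c : R := (2 * M)%:R / q%:R in
  expR 2 * c <= 1 / 4 ->
  \sum_(s in I) (overlap_weight t (phi s))%:R <= 8 * expR 4 * c * N ^+ 2.
Proof.
move=> ddt t0 c.
have [b Eb] : exists b, b = expR 2 * c by exists (expR 2 * c).
rewrite -Eb => b_le.
have c0 : 0 <= c by rewrite divr_ge0.
have b0 : 0 <= b by rewrite Eb mulr_ge0 ?expR_ge0.
(* The term [2 * b ^+ maxn t K] stands for the rest of the series and makes the induction on [K]
   close. *)
have geom K : \sum_(j < K | (t <= j)%N) b ^+ j + 2 * b ^+ maxn t K <= 2 * b ^+ t.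
  elim: K => [|K IHK]; first by rewrite big_ord0 add0r maxn0.
  apply: le_trans IHK; rewrite big_mkcond big_ord_recr /= -big_mkcond /=.
  have bK : 0 <= b ^+ K by rewrite exprn_ge0.
  rewrite -addrA lerD2l; case: leqP => tK.
    rewrite (maxn_idPr (leqW tK)) exprS.
    have : b * b ^+ K <= 1 / 4 * b ^+ K by rewrite ler_wpM2r.
    by lra.
  by rewrite (maxn_idPl tK) add0r.
apply: (@le_trans _ _ (\sum_(j < #|I|.+1 | (t <= j)%N)
    2 * (d ^ d)%:R * expR 2 * N ^+ 2 * b ^+ j)).
  apply: (@le_trans _ _ (\sum_(s in I) \sum_(j < #|I|.+1 | (t <= j)%N)
      N * c ^+ j * (trace_number (phi s :&: heavy j.+1))%:R)).
    by apply: ler_sum => s sI; rewrite overlap_weight_le.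
  rewrite exchange_big /=; apply: ler_sum => j _; rewrite -mulr_sumr.
  apply: le_trans (ler_wpM2l _ (sum_trace_number_le j.+1)) _.
    by rewrite mulr_ge0 ?exprn_ge0 // ltW // N_gt0.
  have -> : expR (2 * j.+1%:R) = expR 2 * expR 2 ^+ j :> R.
    by rewrite expRM_natr exprS.
  have -> : b ^+ j = expR 2 ^+ j * c ^+ j by rewrite Eb exprMn.
  move: (expR 2 ^+ j) (c ^+ j) => u w.
  by rewrite le_eqVlt; apply/orP; left; apply/eqP; ring.
rewrite -mulr_sumr.
have sum_le : \sum_(j < #|I|.+1 | (t <= j)%N) b ^+ j <= 2 * b ^+ t.
  by apply: le_trans (geom #|I|.+1); rewrite lerDl mulr_ge0 ?exprn_ge0.
have dd_le : (d ^ d)%:R <= 2 ^+ t :> R.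
  rewrite -natrX ler_nat; apply: leq_trans (leq_pexp2l _ ddt) => //.
  by rewrite expnM leq_exp2r // ltnW // ltn_expl.
have pow_le : (d ^ d)%:R * b ^+ t <= 2 * b.
  apply: (@le_trans _ _ ((2 * b) ^+ t)).
    by rewrite [leRHS]exprMn ler_wpM2r ?exprn_ge0.
  by rewrite -[leRHS]expr1 ler_wiXn2l ?mulr_ge0 //; lra.
have -> : 8 * expR 4 * c * N ^+ 2 = 4 * expR 2 * N ^+ 2 * (2 * b).
  have -> : expR 4 = expR 2 * expR 2 :> R.
    by rewrite -expRD; congr expR; ring.
  by rewrite Eb; ring.
apply: le_trans (ler_wpM2l _ sum_le) _.
  by rewrite !mulr_ge0 ?expR_ge0 ?exprn_ge0 // ltW // N_gt0.
have -> : 2 * (d ^ d)%:R * expR 2 * N ^+ 2 * (2 * b ^+ t) =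
  4 * expR 2 * N ^+ 2 * ((d ^ d)%:R * b ^+ t) by ring.
by rewrite ler_wpM2l // !mulr_ge0 ?expR_ge0 ?exprn_ge0 // ltW // N_gt0.
Qed.
End SecondMoment.

(** * Recoloring and minimal fragments *)

Section Recoloring.
Variables (V Q J : finType).
Implicit Types (chi : {ffun V -> Q}) (c : Q) (T W : {set V}).

Definition color_class chi c : {set V} := [set v | chi v == c].

Definition recolor chi c T : {ffun V -> Q} :=
  [ffun v => if v \in T then c else chi v].

Lemma color_class_recolor chi c T :
  color_class (recolor chi c T) c = color_class chi c :|: T.
Proof.
by apply/setP=> v; rewrite !inE ffunE; case: ifP; rewrite ?eqxx ?orbT ?orbF.
Qed.

Lemma color_class_recolor_neq chi c c' T :
  c != c' -> [disjoint T & color_class chi c'] ->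
  color_class (recolor chi c T) c' = color_class chi c'.
Proof.
move=> ne dis; apply/setP=> v; rewrite !inE ffunE; case: ifP => // vT.
rewrite (negPf ne); have := disjointFr dis vT; by rewrite inE.
Qed.

Lemma card_recolor_fiber chi' c T :
  (#|[set chi | recolor chi c T == chi']| <= #|Q| ^ #|T|)%N.
Proof.
pose F v : {set Q} := if v \in T then [set: Q] else [set chi' v].
apply: (@leq_trans #|family F|).
  apply: subset_leq_card; apply/subsetP => chi; rewrite in_set => /eqP E.
  apply/familyP => v; rewrite /F -E ffunE.
  by case: ifP => vT; rewrite inE ?vT ?eqxx.
rewrite card_family foldrE big_map big_enum /=.
rewrite (eq_bigr (fun v => if v \in T then #|Q| else 1%N)) => [|v _].
  by rewrite -big_mkcond prod_nat_const.
by rewrite /F; case: ifP; rewrite ?cards1 ?cardsT.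
Qed.

(** For [s] in [I] the default [s] is itself a candidate, so the minimum is genuine; it may be
    attained at another member. *)
Definition fragment W (I : {set J}) (phi : J -> {set V}) (s : J) : {set V} :=
  phi [arg min_(i < s | (i \in I) && (phi i \subset W :|: phi s))
         #|phi i :\: W|] :\: W.

Lemma fragmentP W (I : {set J}) (phi : J -> {set V}) (s : J) : s \in I ->
  exists s', [/\ s' \in I, phi s' \subset W :|: phi s,
    fragment W I phi s = phi s' :\: W &
    forall i, i \in I -> phi i \subset W :|: phi s ->
      #|fragment W I phi s| <= #|phi i :\: W| ]%N.
Proof.
move=> sI; rewrite /fragment; case: arg_minnP => [|i /andP[iI sub] min].
  by rewrite sI subsetUr.
exists i; split=> // i' i'I sub'; by apply: min; rewrite i'I.
Qed.

Lemma fragment_subset W (I : {set J}) (phi : J -> {set V}) (s : J) :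
  s \in I -> fragment W I phi s \subset phi s.
Proof. by case/(fragmentP W phi) => s' [_ sub -> _]; rewrite subDset. Qed.

Lemma fragment_disjoint W (I : {set J}) (phi : J -> {set V}) (s : J) :
  [disjoint fragment W I phi s & W].
Proof. by rewrite /fragment -setI_eq0 setIDAC setDIl setDv setI0. Qed.

(* Recoloring the fragment T of s makes the c-class contain a member of the
   family, and minimality of T forces T to lie inside every member contained in
   the new class. So T is recovered from the new coloring up to the choice of a
   subset of one fixed member. *)
Lemma sum_large_fragments_le (I : {ffun V -> Q} -> {set J})
    (phi : {ffun V -> Q} -> J -> {set V}) (c : Q) (t b N : nat) :
  (forall chi s T, s \in I chi -> T \subset phi chi s ->
     I (recolor chi c T) = I chi /\ phi (recolor chi c T) = phi chi) ->
  (forall chi s, s \in I chi ->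
     overlap_weight (I chi) (phi chi) #|Q| t (phi chi s) * b <= N)%N ->
  ((\sum_chi #|[set s in I chi |
      t <= #|fragment (color_class chi c) (I chi) (phi chi) s|]|) * b
    <= N * #|{ffun V -> Q}|)%N.
Proof.
move=> inv bound.
pose psi chi s := fragment (color_class chi c) (I chi) (phi chi) s.
(* [sel] depends on the coloring alone; evaluated after recoloring, it provides the fixed member
   that contains [T]. *)
pose sel chi := [pick s | (s \in I chi) && (phi chi s \subset color_class chi c)].
pose ok chi s T := [&& s \in I chi, t <= #|T| & T \subset phi chi s]%N &&
  (if sel chi is Some s' then T \subset phi chi s' else false).
have okP chi s T : s \in I chi -> psi chi s = T -> (t <= #|T|)%N ->
    ok (recolor chi c T) s T.
  move=> sI ET tT; have Ts : T \subset phi chi s.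
    by rewrite -ET fragment_subset.
  have [EI Ephi] := inv chi s T sI Ts.
  rewrite /ok /sel EI Ephi sI tT Ts color_class_recolor /=.
  have [s1 [s1I sub1 E1 min]] := fragmentP (color_class chi c) (phi chi) sI.
  rewrite -/(psi chi s) ET in E1 min.
  case: pickP => [s2 /andP[s2I sub2]|/(_ s1)]; last first.
    by rewrite s1I -subDset -E1 subxx.
  have le2 : phi chi s2 :\: color_class chi c \subset T by rewrite subDset.
  have /min le3 : s2 \in I chi by [].
  have /le3 le4 : phi chi s2 \subset color_class chi c :|: phi chi s.
    by apply: subset_trans sub2 _; rewrite setUS.
  have /eqP <- : phi chi s2 :\: color_class chi c == T by rewrite eqEcard le2.
  exact: subsetDl.
have le_chi chi' : ((\sum_s \sum_(T | ok chi' s T) #|Q| ^ #|T|) * b <= N)%N.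
  have [s' Es'|none] := pickP (fun s => Some s == sel chi'); last first.
    rewrite big1 // => s _; rewrite big1 // => T; rewrite /ok.
    by case E: (sel chi') (none) => [s'|] h; rewrite ?andbF //;
      have := h s'; rewrite eqxx.
  have s'I : s' \in I chi'.
    by move: Es'; rewrite /sel; case: pickP => // s2 /andP[h _] /eqP[->].
  apply: leq_trans (bound chi' s' s'I); rewrite leq_mul2r; apply/orP; right.
  rewrite /overlap_weight.
  under [leqRHS]eq_bigr do rewrite mulnC /degree -sum_nat_const.
  rewrite [leqRHS](exchange_big_dep predT) //=; apply: leq_sum => s _.
  rewrite big_mkcond [leqRHS]big_mkcond; apply: leq_sum => T _.
  rewrite /ok -(eqP Es') inE; case: ifP => // /andP[/and3P[-> -> ->] ->] //.
rewrite [leqRHS]mulnC -sum_nat_const big_distrl /=.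
(* Each [s] with a large fragment is counted once, at [T] its fragment and [chi'] the recoloring, so
   that the sum can be regrouped by [chi']. *)
have fiber chi : (#|[set s in I chi | t <= #|psi chi s|]| =
    \sum_chi' \sum_s \sum_T [&& s \in I chi, psi chi s == T, t <= #|T| &
      recolor chi c T == chi'])%N.
  rewrite exchange_big -sum1_card big_mkcond; apply: eq_bigr => s _ /=.
  rewrite exchange_big (bigD1 (psi chi s)) //= eqxx.
  rewrite (bigD1 (recolor chi c (psi chi s))) //= eqxx !andbT inE.
  rewrite big1 => [|chi' /negPf ne]; last by rewrite eq_sym ne !andbF.
  rewrite big1 => [|T /negPf ne]; first by case: ifP.
  by rewrite big1 // => chi' _; rewrite eq_sym ne andbF.
under eq_bigr do rewrite fiber big_distrl.
rewrite exchange_big /=; apply: leq_sum => chi' _.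
apply: leq_trans (le_chi chi'); rewrite -big_distrl leq_mul2r /=.
apply/orP; right; rewrite exchange_big; apply: leq_sum => s _ /=.
rewrite exchange_big [leqRHS]big_mkcond; apply: leq_sum => T _ /=.
case: ifPn => [_|/negP nok].
  apply: leq_trans (card_recolor_fiber chi' c T).
  rewrite -[leqRHS]sum1_card [leqRHS]big_mkcond; apply: leq_sum => chi _.
  by rewrite inE; case: (recolor chi c T == chi'); rewrite ?andbF //; case: andP.
rewrite big1 // => chi _; case: and4P => // -[sI /eqP ET tT /eqP Echi].
by case: nok; rewrite -Echi okP.
Qed.
End Recoloring.

(** * Exposing color classes round by round *)

Section Iteration.
Variables (V Q J : finType).
Implicit Types (I : {set J}) (phi : J -> {set V}) (chi : {ffun V -> Q}).

Lemma overlap_weight_mono I phi I' phi' M t X :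
  (forall T, degree I' phi' T <= degree I phi T)%N ->
  (overlap_weight I' phi' M t X <= overlap_weight I phi M t X)%N.
Proof. by move=> le; apply: leq_sum => T _; rewrite leq_mul2l le orbT. Qed.

(** By spread each term is at most |I| / (4K)^(2^i), and [X] has at most 4^(2^i) subsets; the
    remaining K^(2^i) absorbs 2^(i+6). *)
Lemma overlap_weight_small I phi M K (X : {set V}) (i : nat) :
  (forall A, degree I phi A * (4 * K * M) ^ #|A| <= #|I|)%N ->
  (2 ^ 6 <= K)%N -> (#|X| <= 2 ^ i.+1)%N ->
  (overlap_weight I phi M (2 ^ i) X * 2 ^ (i + 6) <= #|I|)%N.
Proof.
move=> spread K_ge X_le.
have K0 : (0 < K)%N by apply: leq_trans K_ge; rewrite expn_gt0.
have le1 : (overlap_weight I phi M (2 ^ i) X * (4 * K) ^ (2 ^ i)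
    <= 2 ^ #|X| * #|I|)%N.
  rewrite big_distrl -card_powerset -sum_nat_const /=.
  rewrite [leqRHS](bigID (fun T : {set V} => 2 ^ i <= #|T|)%N) /=.
  apply: leq_trans (leq_addr _ _).
  rewrite (eq_bigl (fun T : {set V} => (T \in powerset X) && (2 ^ i <= #|T|)%N));
    last by move=> T; rewrite powersetE.
  apply: leq_sum => T /andP[_ Ti]; apply: leq_trans (spread T).
  rewrite [Y in (_ <= _ * Y)%N]expnMn [leqLHS]mulnAC mulnC.
  rewrite leq_mul2l; apply/orP; right; rewrite mulnC leq_mul2r.
  by rewrite leq_pexp2l ?orbT // muln_gt0.
have le2 : (2 ^ (i + 6) <= K ^ (2 ^ i))%N.
  apply: (@leq_trans ((2 ^ 6) ^ (2 ^ i))); last by rewrite leq_exp2r ?expn_gt0.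
  rewrite -expnM leq_exp2l //.
  have : (i < 2 ^ i)%N by apply: ltn_expl.
  by move: (2 ^ i)%N => m; lia.
rewrite -(@leq_pmul2l (4 ^ (2 ^ i))) ?expn_gt0 //.
apply: leq_trans (leq_trans le1 _).
  by rewrite expnMn mulnCA leq_mul2l leq_mul2l le2 !orbT.
rewrite leq_mul2r; apply/orP; right.
by rewrite -[4%N]/(2 ^ 2)%N -expnM -expnS leq_exp2l.
Qed.

(** A state pairs the surviving members with their current fragments; [p] pairs the new class with
    the size at which a fragment disqualifies its member. *)
Definition refine (p : {set V} * nat) (st : {set J} * (J -> {set V})) :=
  let psi := fragment p.1 st.1 st.2 in
  ([set s in st.1 | #|psi s| < p.2]%N, psi).

Definition history I phi (ws : seq ({set V} * nat)) := foldr refine (I, phi) ws.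

Lemma history_subset I phi ws : (history I phi ws).1 \subset I.
Proof.
elim: ws => //= w ws IH; apply: subset_trans IH.
by apply/subsetP => s; rewrite inE => /andP[].
Qed.

Lemma history_shrink I phi ws s :
  s \in (history I phi ws).1 -> (history I phi ws).2 s \subset phi s.
Proof.
elim: ws => //= w ws IH; rewrite inE => /andP[sI _].
exact: subset_trans (fragment_subset _ _ sI) (IH sI).
Qed.

(** Members are dropped and fragments shrink, so the initial spread bound persists, relative to the
    original [#|I|]. *)
Lemma degree_history I phi ws T :
  (degree (history I phi ws).1 (history I phi ws).2 T <= degree I phi T)%N.
Proof.
apply: subset_leq_card; apply/subsetP => s; rewrite !inE => /andP[sI sub].
rewrite (subsetP (history_subset I phi ws) _ sI).
exact: subset_trans sub (history_shrink sI).
Qed.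

Lemma history_disjoint I phi ws s w :
  s \in (history I phi ws).1 -> w \in ws ->
  [disjoint (history I phi ws).2 s & w.1].
Proof.
elim: ws => //= w1 ws IH; rewrite inE => /andP[sI _].
rewrite inE => /predU1P[->|wws]; first exact: fragment_disjoint.
exact: disjointWl (fragment_subset _ _ sI) (IH sI wws).
Qed.

(** Each fragment is an earlier fragment of some member minus the new class; going back through the
    rounds leads to an original member, possibly not [s]. *)
Lemma history_cover I phi ws s : s \in (history I phi ws).1 ->
  exists2 s0, s0 \in I &
    phi s0 \subset (history I phi ws).2 s :|: \bigcup_(w <- ws) w.1.
Proof.
elim: ws s => /= [s sI|w ws IH s]; first by exists s; rewrite // subsetUl.
rewrite inE => /andP[sI _].
have [s1 [s1I _ -> _]] := fragmentP w.1 (history I phi ws).2 sI.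
have [s0 s0I sub] := IH s1 s1I; exists s0 => //; rewrite big_cons.
apply: subset_trans sub _; rewrite setUA setSU //.
by rewrite setUC -subDset subxx.
Qed.

Definition rounds I phi chi (l : seq (Q * nat)) :=
  history I phi [seq (color_class chi p.1, p.2) | p <- l].

(** Current fragments avoid all earlier classes, so giving a fresh color to part of one changes no
    earlier round: the invariance required by [sum_large_fragments_le]. *)
Lemma rounds_recolor I phi chi l c s (T : {set V}) :
  c \notin unzip1 l -> s \in (rounds I phi chi l).1 ->
  T \subset (rounds I phi chi l).2 s ->
  rounds I phi (recolor chi c T) l = rounds I phi chi l.
Proof.
move=> cl sI Ts; rewrite /rounds; congr history; apply/eq_in_map => p pl.
congr pair; apply: color_class_recolor_neq.
  by apply: contraNneq cl => ->; apply: map_f.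
have wp := map_f (fun p => (color_class chi p.1, p.2)) pl.
exact: disjointWl Ts (history_disjoint sI wp).
Qed.

Lemma rounds_step I phi l c t b N : c \notin unzip1 l ->
  (forall chi s, s \in (rounds I phi chi l).1 ->
     overlap_weight (rounds I phi chi l).1 (rounds I phi chi l).2 #|Q| t
       ((rounds I phi chi l).2 s) * b <= N)%N ->
  ((\sum_chi #|(rounds I phi chi l).1|) * b <=
   (\sum_chi #|(rounds I phi chi ((c, t) :: l)).1|) * b + N * #|{ffun V -> Q}|)%N.
Proof.
move=> cl bound.
have inv chi s (T : {set V}) : s \in (rounds I phi chi l).1 ->
    T \subset (rounds I phi chi l).2 s ->
    (rounds I phi (recolor chi c T) l).1 = (rounds I phi chi l).1 /\
    (rounds I phi (recolor chi c T) l).2 = (rounds I phi chi l).2.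
  by move=> sI Ts; rewrite (rounds_recolor cl sI Ts).
have := sum_large_fragments_le inv bound; rewrite -(leq_add2l
  ((\sum_chi #|(rounds I phi chi ((c, t) :: l)).1|) * b)%N).
apply: leq_trans; rewrite -mulnDl -big_split leq_mul2r /=.
apply/orP; right; apply: leq_sum => chi _.
set st := rounds I phi chi l; rewrite -/(history I phi _) -/(rounds I phi chi l).
rewrite -(cardsID [set s | #|fragment (color_class chi c) st.1 st.2 s| < t]%N st.1).
apply: eq_leq; congr (_ + _)%N; apply: eq_card => s; rewrite !inE //.
by rewrite -leqNgt andbC.
Qed.
End Iteration.

(** * Random colorings hit a spread family *)

Section Spread.
Variables (R : realType) (V J : finType).
Variables (I : {set J}) (phi : J -> {set V}) (M K d : nat).
Hypothesis spread : forall A, (degree I phi A * (4 * K * M) ^ #|A| <= #|I|)%N.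
Hypothesis few_traces :
  forall X, (trace_number I phi X <= \sum_(i < d.+1) 'C(#|X|, i))%N.
Hypothesis K_ge : 16 * 16 * 16 * 16 <= K%:R :> R.
Hypothesis d_gt0 : (0 < d)%N.
Hypothesis M_gt0 : (0 < M)%N.
Hypothesis I_gt0 : (0 < #|I|)%N.

Definition good_members (t : nat) : {set J} :=
  [set s in I | overlap_weight I phi M t (phi s) * 16 <= #|I|]%N.

(** Markov's inequality: for spread [4 * K * M] the ratio c is 1/(2K), and K >= 16^4 makes the mean
    weight at most |I|/64, so at most a quarter of the members exceed |I|/16. *)
Lemma card_good_members (t : nat) : (d * d <= t)%N -> (0 < t)%N ->
  (3 * #|I| <= 4 * #|good_members t|)%N.
Proof.
move=> ddt t0.
have e2 : expR 2 <= 16 :> R.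
  have h1 : 1 / 2 <= expR (- (1 / 2)) :> R.
    by apply: le_trans (expR_ge1Dx _); lra.
  have h2 : expR (1 / 2) <= 2 :> R.
    by move: h1; rewrite expRN -[1 / 2]invrK div1r invrK lef_pV2 ?posrE ?expR_gt0.
  have -> : expR 2 = expR (1 / 2) ^+ 4 :> R.
    by rewrite -expRM_natr; congr expR; lra.
  by apply: le_trans (lerXn2r _ _ _ h2) _; rewrite ?nnegrE ?expR_ge0 //; lra.
have e4 : expR 4 <= 256 :> R.
  have -> : expR 4 = expR 2 ^+ 2 :> R by rewrite -expRM_natr; congr expR; lra.
  by apply: le_trans (lerXn2r _ _ _ e2) _; rewrite ?nnegrE ?expR_ge0 //; lra.
have K0 : 0 < K%:R :> R by apply: lt_le_trans K_ge; lra.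
have M1 : 1 <= M%:R :> R by rewrite ler1n.
have q_ge : expR 2 <= (4 * K * M)%:R :> R.
  rewrite !natrM; apply: le_trans e2 _.
  apply: (@le_trans _ _ (4 * K%:R)); first by move: K_ge; lra.
  by rewrite ler_peMr // mulr_ge0 // ltW.
have cE : (2 * M)%:R / (4 * K * M)%:R = 1 / 2 / K%:R :> R.
  by rewrite !natrM; field; rewrite !gt_eqF //; lra.
have Kinv : K%:R^-1 <= 1 / (16 * 16 * 16 * 16) :> R.
  by rewrite div1r lef_pV2 ?posrE //; lra.
have Kinv0 : 0 <= K%:R^-1 :> R by rewrite invr_ge0 ltW.
have e20 : 0 <= expR 2 :> R by rewrite expR_ge0.
have e40 : 0 <= expR 4 :> R by rewrite expR_ge0.
have c_le : expR 2 * (1 / 2 / K%:R) <= 1 / 4 :> R.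
  have : expR 2 * K%:R^-1 <= 16 * (1 / (16 * 16 * 16 * 16)) :> R.
    by rewrite ler_pM.
  by lra.
have := sum_overlap_weight_le spread few_traces q_ge d_gt0 I_gt0 M_gt0 ddt t0.
rewrite /= cE => /(_ c_le) sum_le.
have {}sum_le : \sum_(s in I) (overlap_weight I phi M t (phi s))%:R
    <= (#|I|%:R ^+ 2) / 64 :> R.
  apply: le_trans sum_le _.
  rewrite [leRHS]mulrC ler_wpM2r ?exprn_ge0 //.
  have : expR 4 * K%:R^-1 <= 256 * (1 / (16 * 16 * 16 * 16)) :> R by rewrite ler_pM.
  by lra.
have bad_le : #|I :\: good_members t|%:R * #|I|%:R <= #|I|%:R ^+ 2 / 4 :> R.
  have -> : #|I|%:R ^+ 2 / 4 = 16 * (#|I|%:R ^+ 2 / 64) :> R by lra.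
  apply: le_trans (ler_wpM2l _ sum_le) => //.
  rewrite mulr_sumr [leRHS](big_setID (good_members t)) /=.
  apply: ler_wpDl; first by apply: sumr_ge0 => s _; rewrite mulr_ge0.
  rewrite mulr_natl -sumr_const; apply: ler_sum => s.
  rewrite !inE => /andP[+ sI]; rewrite sI -ltnNge => /ltnW h.
  by rewrite mulrC -natrM ler_nat.
have N0 : 0 < #|I|%:R :> R by rewrite ltr0n.
have le4 : 4 * #|I :\: good_members t|%:R <= #|I|%:R :> R.
  by rewrite -(ler_pM2r N0); lra.
have le4n : (4 * #|I :\: good_members t| <= #|I|)%N by rewrite -(ler_nat R) natrM.
have := cardsID (good_members t) I.
have /setIidPr -> : good_members t \subset I.
  by apply/subsetP => s; rewrite inE => /andP[].
move: le4n; move: #|I :\: _| #|good_members t| #|I| => a b c; clear; lia.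
Qed.

Variables (Q : finType) (k : nat) (color : 'I_k.+1 -> Q).
Hypothesis color_inj : injective color.
Hypothesis M_eq : M = #|Q|.
Hypothesis k_ge : (d * d <= 2 ^ k)%N.

(* The most recent round comes first. The first round reaches fragments of fewer
   than 2 ^ k elements by the second moment bound; each later one halves them. *)
Fixpoint schedule (j : nat) : seq (Q * nat) :=
  let i := (k - j)%N in
  (color (inord i), 2 ^ i)%N :: (if j is j'.+1 then schedule j' else [::]).

(** Rounds use the color indices in decreasing order, so the index [k - j.+1] of the next round is
    fresh. *)
Lemma schedule_colors (j : nat) c : (j <= k)%N ->
  c \in unzip1 (schedule j) -> exists2 i : 'I_k.+1, (k - j <= i)%N & c = color i.
Proof.
elim: j => [|j IH] jk /=; rewrite inE.
  move=> /eqP ->; exists (inord (k - 0)) => //; rewrite inordK; lia.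
case/predU1P => [->|/(IH (ltnW jk))[i ik ->]].
  by exists (inord (k - j.+1)) => //; rewrite inordK; lia.
by exists i => //; lia.
Qed.

Let I0 := good_members (2 ^ k).
Let st chi j := rounds I0 phi chi (schedule j).

Lemma card_rounds_lt (chi : {ffun V -> Q}) (j : nat) s :
  s \in (st chi j).1 -> (#|(st chi j).2 s| < 2 ^ (k - j))%N.
Proof. by case: j => [|j]; rewrite inE => /andP[]. Qed.

(* At least 3/4 of the members are good, the first round loses 1/16 of them on
   average, and the later ones lose a geometric series of sum at most 1/32. *)
Lemma spread_rounds (j : nat) : (j <= k)%N ->
  #|{ffun V -> Q}|%:R * #|I|%:R * (11 / 16 - 2 ^+ j / 2 ^+ k / 32) <=
    (\sum_chi #|(st chi j).1|)%N%:R :> R.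
Proof.
have N0 : 0 < #|I|%:R :> R by rewrite ltr0n.
have X0 : 0 <= #|{ffun V -> Q}|%:R :> R by [].
have pk0 : 0 < 2 ^+ k :> R by rewrite exprn_gt0.
elim: j => [_|j IH jk].
  have step := @rounds_step V Q J I0 phi [::] (color (inord (k - 0))) (2 ^ (k - 0))
    16 #|I| isT.
  have {step} : ((\sum_(chi : {ffun V -> Q}) #|I0|) * 16 <=
      (\sum_chi #|(st chi 0).1|) * 16 + #|I| * #|{ffun V -> Q}|)%N.
    apply: step => chi s /=; rewrite inE subn0 -M_eq => /andP[sI].
    apply: leq_trans; rewrite leq_mul2r /=; apply: overlap_weight_mono => T.
    apply: subset_leq_card; apply/subsetP => s1; rewrite !inE.
    by move=> /andP[/andP[-> _] ->].
  have := card_good_members k_ge (expn_gt0 2 k); rewrite -/I0.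
  rewrite sum_nat_const; set X := #|{ffun V -> Q}|.
  rewrite -(ler_nat R) -[in X in _ -> X -> _](ler_nat R) !(natrM, natrD).
  rewrite expr0 => h1 h2.
  have h3 : X%:R * (3 * #|I|%:R) <= X%:R * (4 * #|I0|%:R) :> R.
    by rewrite ler_wpM2l.
  have h4 : 0 <= X%:R * #|I|%:R * (1 / 2 ^+ k / 32) :> R.
    by rewrite !mulr_ge0 ?invr_ge0 // ltW.
  by lra.
have IHj := IH (ltnW jk).
(* The new round loses on average at most |I| / 2^(i+6) members, exactly the growth of
   [2 ^+ j / 2 ^+ k / 32] when [j] increases by one. *)
pose i := (k - j.+1)%N.
have Ei : (k - j)%N = i.+1 by rewrite /i; lia.
have new : color (inord i) \notin unzip1 (schedule j).
  apply/negP => /(schedule_colors (ltnW jk))[i' le /color_inj E].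
  by move: le; rewrite -E inordK /i; lia.
have step := @rounds_step V Q J I0 phi (schedule j) (color (inord i)) (2 ^ i)
    (2 ^ (i + 6)) #|I| new.
have {step} : ((\sum_chi #|(st chi j).1|) * 2 ^ (i + 6) <=
    (\sum_chi #|(st chi j.+1).1|) * 2 ^ (i + 6) + #|I| * #|{ffun V -> Q}|)%N.
  apply: step => chi s sI; rewrite -M_eq.
  have deg_le T : (degree (st chi j).1 (st chi j).2 T <= degree I phi T)%N.
    apply: leq_trans (degree_history _ _ _ _) _.
    apply: subset_leq_card; apply/subsetP => s1; rewrite !inE.
    by move=> /andP[/andP[-> _] ->].
  apply: leq_trans (@overlap_weight_small V J I phi M K ((st chi j).2 s) i _ _ _).
  - by rewrite leq_mul2r overlap_weight_mono ?orbT.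
  - exact: spread.
  - by rewrite -(ler_nat R) natrX; apply: le_trans K_ge; lra.
  by rewrite -Ei ltnW ?card_rounds_lt.
rewrite -(ler_nat R) !(natrM, natrD) !natrX.
have pi : 2 ^+ k = 2 ^+ i * 2 ^+ j * 2 :> R.
  by rewrite -exprD -exprSr; congr (_ ^+ _); rewrite /i; lia.
have i0 : 0 < 2 ^+ i :> R by rewrite exprn_gt0.
have j0 : 0 < 2 ^+ j :> R by rewrite exprn_gt0.
rewrite pi in IHj *; rewrite exprD [2 ^+ j.+1]exprS.
set p := 2 ^+ i in i0 IHj *; set X := #|{ffun V -> Q}|%:R in X0 IHj *.
have -> : 2 * 2 ^+ j / (p * 2 ^+ j * 2) = p^-1 :> R by field; rewrite !gt_eqF.
have E2 : 2 ^+ j / (p * 2 ^+ j * 2) = p^-1 / 2 :> R by field; rewrite !gt_eqF.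
rewrite E2 in IHj; move: IHj.
set S1 := (\sum_chi _)%N%:R; set S2 := (\sum_chi _)%N%:R => h1 h2.
have {}h2 : S1 <= S2 + X * #|I|%:R * p^-1 / 64.
  have p64 : 0 < p * 2 ^+ 6 by rewrite mulr_gt0 ?exprn_gt0.
  rewrite -(ler_pM2r p64); apply: le_trans h2 _.
  rewrite le_eqVlt; apply/orP; left; apply/eqP; field; rewrite gt_eqF //.
by lra.
Qed.

(** Fragments below the last threshold [2 ^ 0] are empty, so a survivor yields a member covered by
    the classes. On average at least (11/16 - 1/32)|I| members survive and no coloring keeps more
    than |I|, so at least half of the colorings keep one. *)
Lemma spread_family_hit :
  (2 * #|[set chi : {ffun V -> Q} | [forall s in I, ~~ (phi s \subset
      [set v | [exists i, chi v == color i]])]]| <= #|{ffun V -> Q}|)%N.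
Proof.
set bad := [set chi | _].
have N0 : 0 < #|I|%:R :> R by rewrite ltr0n.
have := spread_rounds (leqnn k); rewrite divff ?expf_neq0 ?pnatr_eq0 // => le1.
have le2 : (\sum_chi #|(st chi k).1| <= #|I| * #|~: bad|)%N.
  rewrite mulnC -sum_nat_const [leqRHS]big_mkcond; apply: leq_sum => chi _.
  case: ifP => [_|].
    apply: subset_leq_card; apply: subset_trans (history_subset _ _ _) _.
    by apply/subsetP => s; rewrite inE => /andP[].
  rewrite !inE => /negbFE/'forall_implyP none; rewrite leqn0 cards_eq0.
  apply/eqP/setP => s; rewrite in_set0; apply/negP => sI.
  have [s0 s0I cov] := history_cover sI.
  have s0I' : s0 \in I by move: s0I; rewrite inE => /andP[].
  have /negP[] := none s0 s0I'.
  have fr0 : (st chi k).2 s = set0.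
    apply/eqP; rewrite -cards_eq0 -leqn0 -ltnS.
    by have := card_rounds_lt sI; rewrite subnn.
  apply: subset_trans cov _; rewrite -/(rounds I0 phi chi _) -/(st chi k) fr0 set0U.
  rewrite big_map big_seq; elim/big_ind: _ => [|A B AX BX|p pl].
  - exact: sub0set.
  - by rewrite subUset AX.
  have : p.1 \in unzip1 (schedule k) by apply: map_f.
  move/(schedule_colors (leqnn k)) => [i _ Ei]; apply/subsetP => v.
  by rewrite !inE Ei => h; apply/existsP; exists i.
have : #|{ffun V -> Q}|%:R * (1 / 2) <= #|~: bad|%:R :> R.
  rewrite -(ler_pM2l N0) -natrM; apply: le_trans (_ : _ <= _%:R) _; last first.
    rewrite ler_nat; exact: le2.
  apply: le_trans le1.
  have : 0 <= #|{ffun V -> Q}|%:R * #|I|%:R :> R by rewrite mulr_ge0.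
  by lra.
have := cardsC bad; move: #|bad| #|~: bad| #|{ffun V -> Q}| => a b c <-.
rewrite natrD => h; rewrite -(ler_nat R) natrM natrD; lra.
Qed.
End Spread.

(** * The spread link of a densest core *)

Section Link.
Variables (T : finType) (F : {set {set T}}) (q : nat).

Definition star (A : {set T}) : {set {set T}} := [set S in F | A \subset S].

Definition densest_core : {set T} := [arg max_(A > set0) #|star A| * q ^ #|A|]%N.

Lemma densest_coreP (A : {set T}) :
  (#|star A| * q ^ #|A| <= #|star densest_core| * q ^ #|densest_core|)%N.
Proof. by rewrite /densest_core; case: arg_maxnP => // B _; apply. Qed.

Lemma card_le_densest_core :
  (#|F| <= #|star densest_core| * q ^ #|densest_core|)%N.
Proof.
apply: leq_trans (densest_coreP set0); rewrite cards0 muln1.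
by apply: subset_leq_card; apply/subsetP => S SF; rewrite inE SF sub0set.
Qed.

(** For [A] disjoint from the core [C], the degree counts members containing [A :|: C], and
    maximality of [C] applies; an [A] meeting [C] has degree 0. *)
Lemma degree_link (A : {set T}) : (0 < q)%N ->
  (degree (star densest_core) (fun S => S :\: densest_core) A * q ^ #|A|
    <= #|star densest_core|)%N.
Proof.
set C := densest_core => q0.
have [dis|ndis] := boolP [disjoint A & C]; last first.
  rewrite (_ : degree _ _ _ = 0%N) // /degree; apply/eqP.
  rewrite cards_eq0; apply/eqP/setP => S; rewrite !inE.
  apply: contraNF ndis => /andP[_]; rewrite subsetD => /andP[_]; exact.
rewrite -(@leq_pmul2r (q ^ #|C|)) ?expn_gt0 ?q0 //.
apply: leq_trans (densest_coreP (A :|: C)).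
rewrite cardsU (disjoint_setI0 dis) cards0 subn0 -mulnA -expnD.
rewrite leq_mul2r; apply/orP; right; apply: subset_leq_card.
apply/subsetP => S; rewrite !inE subUset subsetD.
by move=> /andP[/andP[-> ->] /andP[-> _]].
Qed.

(** Removing the core from the members has the same effect on traces as removing it from [X]. *)
Lemma trace_number_link (d : nat) (X : {set T}) : (VC F <= d)%N ->
  (trace_number (star densest_core) (fun S => S :\: densest_core) X
    <= \sum_(i < d.+1) 'C(#|X|, i))%N.
Proof.
move=> vcF; set C := densest_core.
apply: (@leq_trans #|[set S :&: (X :\: C) | S in F]|).
  apply: subset_leq_card; apply/subsetP => B /imsetP[S].
  rewrite inE => /andP[SF _] ->; apply/imsetP; exists S => //.
  by rewrite setIDAC setIDA.
apply: leq_trans (sauer_shelah _ vcF) _; apply: leq_sum => i _.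
by apply: leq_bin2l; rewrite subset_leq_card ?subsetDl.
Qed.
End Link.

(** * Assembling the sunflower *)

(** The kernel is [C]. Injectivity holds because two equal members would coincide with [C], which
    has fewer than [n] elements. *)
Lemma sunflower_of_disjoint_links (T : finType) (r n : nat)
    (F : {set {set T}}) (C : {set T}) (S : 'I_r -> {set T}) :
  uniform_family n F -> (forall i, S i \in F) -> (forall i, C \subset S i) ->
  (#|C| < n)%N ->
  (forall i j, i != j -> [disjoint S i :\: C & S j :\: C]) ->
  contains_sunflower r F.
Proof.
move=> unif SF CS ltC dis; exists S; split=> //.
have SI i j : i != j -> S i :&: S j = C.
  move=> /dis; rewrite -setI_eq0 -setDIl setD_eq0 => sub.
  by apply/eqP; rewrite eqEsubset sub subsetI !CS.
split; last by exists C => i j; apply: SI.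
move=> i j E; apply/eqP; apply/negPn/negP => /SI; rewrite E setIid => EC.
by move: ltC; rewrite -EC unif // ltnn.
Qed.

(** Otherwise every point lies in more than [r] of the [2 * r] bad sets, against an average of at
    most [r]. *)
Lemma many_hit_groups (T G : finType) (r : nat)
    (bad : G -> {set T}) :
  (0 < #|T|)%N -> #|G| = (2 * r)%N ->
  (forall g, 2 * #|bad g| <= #|T|)%N ->
  exists x, (r <= #|[set g | x \notin bad g]|)%N.
Proof.
move=> T0 cG half; apply/existsP; apply: contraT => /existsPn none.
have : (\sum_(x : T) r.+1 <= \sum_(x : T) \sum_(g | x \in bad g) 1)%N.
  apply: leq_sum => x _; rewrite sum1dep_card; set B := [set g | _].
  have CB : ~: B = [set g | x \notin bad g] by apply/setP => g; rewrite !inE.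
  move: (cardsC B) (none x); rewrite cG -CB -ltnNge.
  by move: #|B| #|~: B| => a b; clear; lia.
rewrite (exchange_big_dep predT) //= sum_nat_const.
rewrite (eq_bigr (fun g => #|bad g|)) => [|g _]; last by rewrite sum1_card.
have : (\sum_(g : G) 2 * #|bad g| <= \sum_(g : G) #|T|)%N by apply: leq_sum.
rewrite sum_nat_const -big_distrr /= cG.
by move: (\sum_g _)%N #|T| T0 => s m; clear; nia.
Qed.

Theorem corollary5p1 (R : realType) :
  exists C : R, 0 < C /\
    forall d n r : nat, (1 <= d)%N -> (1 <= n)%N -> (2 <= r)%N ->
    forall (T : finType) (F : {set {set T}}),
      uniform_family n F -> (VC F <= d)%N ->
      (C * r%:R * ln (d + 1)%:R) ^+ n < #|F|%:R ->
      contains_sunflower r F.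
Proof.
have [K K_ge] : exists K : nat, 16 * 16 * 16 * 16 <= K%:R :> R.
  exists (Num.bound (16 * 16 * 16 * 16 : R)).
  by apply/ltW/archi_boundP; rewrite !mulr_ge0.
have K0 : (0 < K)%N.
  by rewrite -(ltr0n R) (lt_le_trans _ K_ge) // !mulr_gt0.
have ln2 : 0 < ln 2 :> R by rewrite ln_gt0 // ltr1n.
(* Below, q = 8Kr(k+1), and k+1 = 2l+3 is at most 5 ln(d+1) / ln 2; hence the 40. *)
exists (40 * K%:R / ln 2); split; first by rewrite divr_gt0 ?mulr_gt0 ?ltr0n.
move=> d n r d1 n1 r2 T F unif vcF big.
pose l := trunc_log 2 d; pose k := (2 * l.+1)%N.
have /andP[l_le l_gt] : (2 ^ l <= d < 2 ^ l.+1)%N by apply: trunc_log_bounds.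
have k_ge : (d * d <= 2 ^ k)%N.
  by rewrite /k mulnC expnM -mulnn leq_mul // ltnW.
pose Q : finType := ('I_(2 * r) * 'I_k.+1)%type.
have cQ : #|Q| = (2 * r * k.+1)%N by rewrite card_prod !card_ord.
have Q0 : (0 < #|Q|)%N by rewrite cQ !muln_gt0 (ltnW r2).
pose q := (4 * K * #|Q|)%N.
have q0 : (0 < q)%N by rewrite !muln_gt0 K0.
have q_le : q%:R <= 40 * K%:R / ln 2 * r%:R * ln (d + 1)%:R :> R.
  have ln_l : l%:R * ln 2 <= ln (d + 1)%:R :> R.
    rewrite mulr_natl -lnXn // ler_ln ?posrE ?exprn_gt0 ?ltr0n ?addn1 //.
    by rewrite -natrX ler_nat (leq_trans l_le).
  have ln_1 : ln 2 <= ln (d + 1)%:R :> R.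
    by rewrite ler_ln ?posrE ?ltr0n ?addn1 // ler_nat ltnS.
  have le5 : k.+1%:R <= 5 * (ln (d + 1)%:R / ln 2) :> R.
    rewrite mulrA ler_pdivlMr // /k -natr1 natrM -natr1; lra.
  rewrite /q cQ !natrM.
  have -> : 4 * K%:R * (2 * r%:R * k.+1%:R) = 8 * K%:R * r%:R * k.+1%:R :> R.
    by ring.
  have -> : 40 * K%:R / ln 2 * r%:R * ln (d + 1)%:R =
    8 * K%:R * r%:R * (5 * (ln (d + 1)%:R / ln 2)) :> R by field; rewrite gt_eqF.
  by rewrite ler_wpM2l // !mulr_ge0.
have {}big : (q ^ n < #|F|)%N.
  rewrite -(ltr_nat R) natrX; apply: le_lt_trans big.
  by rewrite lerXn2r ?nnegrE // (le_trans _ q_le).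
pose C := densest_core F q; pose I := star F C.
pose phi (S : {set T}) := S :\: C.
have F_le : (#|F| <= #|I| * q ^ #|C|)%N := card_le_densest_core F q.
have I0 : (0 < #|I|)%N.
  by case: #|I| F_le => // F0; move: big; rewrite ltnNge (leq_trans F0).
(* If [#|C| = n], the star of [C] contains at most [C] itself, so [#|F| <= q ^ n], a
   contradiction. *)
have ltC : (#|C| < n)%N.
  have /card_gt0P[S] := I0; rewrite inE => /andP[SF CS].
  rewrite ltn_neqAle -{2}(unif S SF) subset_leq_card // andbT.
  apply: contraL big => /eqP Cn; rewrite -leqNgt (leq_trans F_le) // Cn.
  rewrite -[leqRHS]mul1n leq_mul2r; apply/orP; right.
  rewrite -(cards1 C); apply: subset_leq_card; apply/subsetP => S'.
  rewrite !inE => /andP[S'F CS']; rewrite eq_sym eqEcard CS' Cn.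
  by rewrite /= (unif S' S'F) leqnn.
pose bad (g : 'I_(2 * r)) := [set chi : {ffun T -> Q} |
  [forall s in I, ~~ (phi s \subset [set v | [exists i : 'I_k.+1, chi v == (g, i)]])]].
have half g : (2 * #|bad g| <= #|{ffun T -> Q}|)%N.
  apply: (@spread_family_hit R T _ I phi #|Q| K d _ _ K_ge d1 Q0 I0 Q k
    (fun i => (g, i))) => //.
  - by move=> A; apply: degree_link.
  - by move=> X; apply: trace_number_link.
  - by move=> i j [].
have T0 : (0 < #|{ffun T -> Q}|)%N by rewrite card_ffun expn_gt0 Q0.
have [chi r_le] := many_hit_groups T0 (card_ord _) half.
pose g (i : 'I_r) := enum_val (widen_ord r_le i).
have g_inj : injective g by move=> i j /enum_val_inj/(congr1 val)/= /val_inj.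
have hit (i : 'I_r) : exists S, S \in I /\
    phi S \subset [set v | (chi v).1 == g i].
  have := enum_valP (widen_ord r_le i); rewrite inE -/(g i) inE.
  rewrite negb_forall_in => /exists_inP[S SI]; rewrite negbK => sub.
  exists S; split=> //; apply: subset_trans sub _; apply/subsetP => v.
  by rewrite !inE => /existsP[i' /eqP ->].
have [S /all_and2[SI sub]] := fin_all_exists hit.
have SF i : S i \in F /\ C \subset S i.
  by move: (SI i); rewrite inE => /andP[].
apply: (@sunflower_of_disjoint_links _ _ _ _ C S unif _ _ ltC) => [i|i|i j ij].
- by case: (SF i).
- by case: (SF i).
(* A common point of two petals would have its color in two different groups. *)
rewrite -setI_eq0; apply/eqP/setP => v; rewrite in_set0; apply/negP.
move=> /setIP[/(subsetP (sub i)) + /(subsetP (sub j))].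
rewrite !inE => /eqP -> /eqP /g_inj E; by rewrite E eqxx in ij.
Qed.
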